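(* Let $G$ be a finitely generated sofic group, let $A$ be a finite alphabet (a finite set), let $M\subset G$ be finite, and let $S=A^{A^M}$. Let $s\in S^G$ be asymptotically constant such that $\sigma_s\colon A^G\to A^G$ is stably post-surjective. Then $\sigma_s$ is stably invertible.
   Context: Sofic group (standard notion): $G$ is sofic if for every finite $K\subset G$ and every $\varepsilon>0$ there exist $n\ge 1$ and a map $\varphi\colon G\to \mathrm{Sym}(n)$ with $d_H(\varphi(gh),\varphi(g)\varphi(h))\le\varepsilon$ for all $g,h\in K$ and $d_H(\varphi(g),\varphi(h))\ge 1-\varepsilon$ for all distinct $g,h\in K$, where $d_H$ is the normalized Hamming distance. For a set $B$, $B^G$ is the set of maps (configurations) $G\to B$, with the prodiscrete topology (product of discrete topologies) and the shift action $(gx)(h)=x(g^{-1}h)$ for $g,h\in G$, $x\in B^G$. For $x\in B^G$, $\Sigma(x)=\overline{\{gx: g\in G\}}\subset B^G$. Two configurations $x,y\in B^G$ are asymptotic if $x|_{G\setminus E}=y|_{G\setminus E}$ for some finite $E\subset G$; a configuration is asymptotically constant if it is asymptotic to a constant configuration. $S=A^{A^M}$ is the set of all maps $A^M\to A$. For $s\in S^G$, the non-uniform cellular automaton (NUCA) $\sigma_s\colon A^G\to A^G$ is defined by $\sigma_s(x)(g)=s(g)\big((g^{-1}x)|_M\big)$ for $x\in A^G$, $g\in G$. $\sigma_s$ is post-surjective if for all $x,y\in A^G$ with $y$ asymptotic to $\sigma_s(x)$, there is $z\in A^G$ asymptotic to $x$ with $\sigma_s(z)=y$. $\sigma_s$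 is stably post-surjective if $\sigma_p$ is post-surjective for every $p\in\Sigma(s)\subset S^G$. $\sigma_s$ is stably invertible if there exist a finite set $N\subset G$ and $t\in T^G$, where $T=A^{A^N}$, such that for every $p\in\Sigma(s)$ there is some $q\in\Sigma(t)$ with $\sigma_p\circ\sigma_q=\sigma_q\circ\sigma_p=\mathrm{Id}$. *)

(* Defs.v *)
From HB Require Import structures.
From mathcomp Require Import all_boot all_order all_algebra all_fingroup.
From mathcomp Require Import finmap.
From mathcomp Require Import boolp classical_sets functions reals topology.

Set Implicit Arguments.
Unset Strict Implicit.
Unset Printing Implicit Defensive.

Local Open Scope classical_set_scope.
Local Open Scope fset_scope.
Local Open Scope group_scope.

Definition finitely_generated (G : groupType) : Prop :=
  exists X : {fset G},
    smallest (fun H : set G => group_closed [in H]) [set` X] = setT.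

Definition hamming (R : realType) (n : nat) (s t : 'S_n) : R :=
  (#|[set i | s i != t i]%SET|%:R / n%:R)%R.

(* The product of 'S_n applies its left factor first. The opposite convention
   gives the same class of groups, since [hamming] is invariant under
   inversion: replace [phi] by [fun g => (phi g)^-1]. *)
Definition sofic (R : realType) (G : groupType) : Prop :=
  forall (K : {fset G}) (eps : R), (0 < eps)%R ->
  exists (n : nat) (phi : G -> 'S_n),
    [/\ (0 < n)%N,
        forall g h, g \in K -> h \in K ->
          (hamming R (phi (g * h)%g) (phi g * phi h)%g <= eps)%R
      & forall g h, g \in K -> h \in K -> g != h ->
          (1 - eps <= hamming R (phi g) (phi h))%R].

Definition shift (G : groupType) (B : Type) (g : G) (x : G -> B) : G -> B :=
  fun h => x (g^-1 * h).

(* Closure in the prodiscrete topology. *)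
Definition orbit_closure (G : groupType) (B : choiceType) (x : G -> B) :
    set (G -> B) :=
  @closure {ptws G -> discrete_topology B} (range (fun g : G => shift g x)).

Definition asymptotic (G : groupType) (B : Type) (x y : G -> B) : Prop :=
  exists E : {fset G}, forall g, g \notin E -> x g = y g.

Definition asymptotically_constant (G : groupType) (B : Type) (x : G -> B) :
    Prop :=
  exists b : B, asymptotic x (fun=> b).

Definition local_maps (G : groupType) (A : finType) (M : {fset G}) : finType :=
  {ffun {ffun M -> A} -> A}.

Definition nuca (G : groupType) (A : finType) (M : {fset G})
    (s : G -> local_maps A M) (x : G -> A) : G -> A :=
  fun g => s g [ffun m : M => shift g^-1 x (val m)].

Definition post_surjective (G : groupType) (A : finType)
    (tau : (G -> A) -> (G -> A)) : Prop :=
  forall x y : G -> A, asymptotic y (tau x) ->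
  exists2 z : G -> A, asymptotic z x & tau z = y.

Definition stably_post_surjective (G : groupType) (A : finType) (M : {fset G})
    (s : G -> local_maps A M) : Prop :=
  forall p, orbit_closure s p -> post_surjective (nuca p).

Definition stably_invertible (G : groupType) (A : finType) (M : {fset G})
    (s : G -> local_maps A M) : Prop :=
  exists (N : {fset G}) (t : G -> local_maps A N),
  forall p, orbit_closure s p ->
  exists2 q, orbit_closure t q &
    nuca p \o nuca q = id /\ nuca q \o nuca p = id.

(* Main.v *)
Require Import Defs.
From mathcomp Require Import all_boot all_order all_algebra all_fingroup finmap.
From mathcomp Require Import reals zify.

Set Implicit Arguments.
Unset Strict Implicit.
Unset Printing Implicit Defensive.

(** The configuration [s] differs from a constant [c] in finitely many cells,
so [nuca s] is a finite perturbation of the cellular automaton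
[tau := nuca (fun=> c)]. Suppose first that [G] is infinite. Then [c] is a limit
of translates of [s], so [tau] is post-surjective, and the proof inverts [tau]
first and the perturbation afterwards.

Inverting [tau]. By compactness there is one finite set [E] such that any
change of [tau x] at the cell [1] can be produced by changing [x] inside [E]
only ([post_surjective_corrects]). Soficity then makes [tau] pre-injective
([sofic_pre_injective]): run [tau] on a finite model [V] of [G], that is, on
the points of a permutation approximation of [G]. Correcting the image one cell
after the other shows that the image reaches every pattern on the good points
of [V], which are nearly all of [V]. If two distinct asymptotic configurations
had the same image, then a fixed finite pattern could be replaced by another
one, without changing the image, around a positive proportion of disjointly
placed good points; so the inputs avoiding that pattern there would already
reach the whole image, and they are exponentially too few.

Pre-injectivity and the uniform [E] give an inverse with finite memory
([local_inverse]). Let [tau x] and [tau x'] agree on [E^-1]. Copy [x'] into [x]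
on a finite set, and undo the effect on the image by corrections, which are all
centred outside [E^-1], hence none of them reaches the cell [1]. By
pre-injectivity the corrected configuration is the copy, whence [x 1 = x' 1]:
the value of [x] at a cell is read off a finite part of [tau x].

Inverting the perturbation. The map [tau^-1 \o nuca s] is still
post-surjective, and it fixes the values outside a finite set [D]. With the
values outside [D] prescribed, it is a surjection of the finite set [A^D] to
itself, hence a bijection; so it has an inverse of the same shape
([perturbation_inverse]). Composing, [nuca s] has an inverse with finite memory
that agrees with [tau^-1] outside a finite set, i.e. an inverse [nuca t] with
[t] asymptotic to a constant [d] for which [nuca (fun=> d)] inverts [tau].

A point of the orbit closure of [s] is a translate of [s] or the constant [c];
the matching point of the orbit closure of [t] is the same translate of [t] or
the constant [d]. If [G] is finite, then [nuca s] itself is the identity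
outside the finite set [G], and the orbit closure is the orbit. *)

(** * Counting *)

Section Counting.

(** Bernoulli's inequality for [(1 + 1 / b) ^ k], cleared of denominators. *)
Lemma leq_bernoulli b k : b ^ k * (b + k) <= b.+1 ^ k * b.
Proof.
elim: k => [|k IH]; first by rewrite !expn0 !mul1n addn0.
rewrite !expnS -[b.+1 * _ * _]mulnA; move: IH.
move: (b ^ k) (b.+1 ^ k) => X Y IH.
apply: (@leq_trans (b.+1 * (X * (b + k)))); last by rewrite leq_mul2l IH orbT.
rewrite mulnAC [X in _ <= X]mulnCA mulnC leq_mul2l; apply/orP; right; nia.
Qed.

Lemma leq_exp_pred_double b : 2 * b ^ b.+1 <= b.+1 ^ b.+1.
Proof.
case: b => [//|b].
rewrite -(@leq_pmul2r b.+1) //; apply: leq_trans (leq_bernoulli _ _).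
by rewrite mulnAC mulnC leq_mul2l; apply/orP; right; lia.
Qed.

(** Forbidding one of the [b.+1] letters at [b.+1 * a] places costs at least a
factor [a]: each block of [b.+1] places costs a factor [2], and [a <= 2 ^ a]. *)
Lemma exp_pred_gap a b : b ^ (b.+1 * a) * a <= b.+1 ^ (b.+1 * a).
Proof.
apply: (@leq_trans ((2 * b ^ b.+1) ^ a)).
  by rewrite expnMn -expnM mulnC leq_mul2r ltnW ?orbT // ltn_expl.
rewrite [X in _ <= X]expnM; case: a => [//|a].
by rewrite leq_exp2r // leq_exp_pred_double.
Qed.

(** In the application [a] is the size of the alphabet and [b.+1] the number of
patterns on a fixed window. The models have [q] good and [m] bad points, and
avoiding a pattern at [u] disjoint places costs more than the factor [a ^ m]
by which the patterns on the good points are fewer than all patterns. *)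
Lemma counting_contradiction a b m q n u : 0 < b ->
  a ^ q * b.+1 ^ u <= b ^ u * a ^ n -> n = q + m -> b.+1 * a * m < u -> 0 < a ->
  False.
Proof.
move=> b0 le_au nE ltu a0; move: le_au; rewrite {}nE.
rewrite expnD mulnCA leq_pmul2l ?expn_gt0 ?a0 // leqNgt => /negP; apply.
set L := b.+1 * a in ltu.
rewrite -(subnKC (ltnW ltu)) !expnD mulnAC.
apply: (@leq_ltn_trans (b.+1 ^ (L * m) * b ^ (u - L * m))).
  rewrite leq_mul2r !(expnM _ L) -expnMn; apply/orP; right.
  case: (m) => [//|k]; by rewrite leq_exp2r // exp_pred_gap.
by rewrite ltn_pmul2l ?expn_gt0 // ltn_exp2r ?subn_gt0.
Qed.

(** The factor [l.+1], rather than [l], is what makes the conclusion strict when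
[0 < m]; when [m = 0] strictness comes from [0 < n]. *)
Lemma packing_density k l m q n u : 0 < k -> 0 < n -> q + m = n ->
  (k * l.+1).+1 * m <= n -> q <= u * k -> l * m < u.
Proof.
move=> k0 n0 qm le_mn le_qu.
have le_mu : l.+1 * m <= u by rewrite -(leq_pmul2r k0); nia.
by case: m => [|m] in qm le_mn le_mu *; nia.
Qed.

(** The translates [c u @: W] are disjoint, so a pattern amounts to a family of
patterns on them, each different from [p], and a free pattern on the remaining
cells. *)
Lemma card_avoiding (V W A : finType) (U : {set V}) (c : V -> W -> V)
    (p : {ffun W -> A}) (B : {set {ffun V -> A}}) :
  (forall u u' w w', u \in U -> u' \in U -> c u w = c u' w' -> u = u' /\ w = w') ->
  (forall xi u, xi \in B -> u \in U -> [ffun w => xi (c u w)] != p) ->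
  #|B| * (#|A| ^ #|W|) ^ #|U| <= (#|A| ^ #|W|).-1 ^ #|U| * #|A| ^ #|V|.
Proof.
move=> cinj avoid.
pose cells := [set c (val uw.1) uw.2 | uw : {u | u \in U} * W].
have card_cells : #|cells| = #|U| * #|W|.
  rewrite card_imset ?card_prod ?card_sig // => -[u w] [u' w'] /= cc.
  have [uu ->] := cinj _ _ _ _ (valP u) (valP u') cc.
  by congr (_, _); apply: val_inj.
pose e (xi : {ffun V -> A}) :=
  ([ffun u : {u | u \in U} => [ffun w => xi (c (val u) w)]],
   [ffun v : {v | v \in ~: cells} => xi (val v)]).
have e_inj : injective e.
  move=> xi xi' [exi rxi]; apply/ffunP => v.
  have [/imsetP[[u w] _ ->]|vc] := boolP (v \in cells).
    by have /ffunP/(_ u) := exi; rewrite !ffunE => /ffunP/(_ w); rewrite !ffunE.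
  rewrite -in_setC in vc; have /ffunP/(_ (exist _ v vc)) := rxi.
  by rewrite !ffunE.
have cardB : #|B| <= (#|A| ^ #|W|).-1 ^ #|U| * #|A| ^ #|~: cells|.
  rewrite -(card_imset _ e_inj).
  pose S := setX [set f in @ffun_on {u | u \in U} (predC1 p)]
                 [set: {ffun {v | v \in ~: cells} -> A}].
  have -> : (#|A| ^ #|W|).-1 ^ #|U| * #|A| ^ #|~: cells| = #|S|.
    rewrite cardsX cardsT card_ffun card_sig; congr (_ * _ ^ _).
      have cU : #|{: {u | u \in U}}| = #|U| by rewrite card_sig; apply: eq_card.
      rewrite -card_ffun -(cardC1 p) -cU -card_ffun_on.
      by apply: eq_card => f; rewrite inE.
  apply: subset_leq_card; apply/subsetP => _ /imsetP[xi xiB ->].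
  rewrite !inE andbT; apply/ffun_onP => u; rewrite ffunE inE.
  exact: avoid (valP u).
apply: leq_trans (leq_mul cardB (leqnn _)) _.
rewrite -mulnA leq_mul2l -expnM -expnD; apply/orP; right.
rewrite mulnC -card_cells addnC cardsC; exact: leqnn.
Qed.

(** A maximal [r]-independent subset of [Q]. *)
Lemma packing (V : finType) (Q : {set V}) (r : rel V) :
  symmetric r -> {in Q, reflexive r} ->
  exists U : {set V}, [/\ U \subset Q,
    forall u u', u \in U -> u' \in U -> r u u' -> u = u'
  & forall v, v \in Q -> exists2 u, u \in U & r u v].
Proof.
move=> r_sym r_refl.
pose P (U : {set V}) := (U \subset Q) &&
  [forall u in U, forall u' in U, r u u' ==> (u == u')].
have [|U /maxsetP[/andP[UQ /forall_inP UP] Umax]] := @ex_maxset V P.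
  by exists set0; rewrite /P sub0set; apply/forall_inP => u; rewrite inE.
have Usep u u' : u \in U -> u' \in U -> r u u' -> u = u'.
  by move=> uU u'U ruu'; have /forall_inP/(_ _ u'U) := UP u uU; rewrite ruu' => /eqP.
exists U; split=> // v vQ; case: (boolP [exists u in U, r u v]) => [/exists_inP//|].
rewrite negb_exists_in => /forall_inP vU.
have vnU : v \notin U by apply/negP => /vU; rewrite r_refl.
case/negP: vnU; rewrite -(Umax (v |: U)) ?setU11 ?subsetU1 //.
apply/andP; split; first by apply/subsetP => u /setU1P[->//|]; apply/subsetP.
apply/forall_inP => u /setU1P[->|uU]; apply/forall_inP => u' /setU1P[->|u'U].
- by rewrite eqxx implybT.
- by rewrite r_sym (negPf (vU _ u'U)).
- by rewrite (negPf (vU _ uU)).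
- by apply/implyP => /Usep-> //.
Qed.

End Counting.

From mathcomp Require Import boolp classical_sets functions cardinality topology.

Local Open Scope classical_set_scope.
Local Open Scope fset_scope.
Local Open Scope group_scope.

(** * Compactness and orbit closures *)

(** The filter of finite sets ordered by inclusion. *)
Definition eventually_fset (T : choiceType) : set_system {fset T} :=
  filter_from setT (fun E : {fset T} => [set F : {fset T} | E `<=` F]).

Lemma eventually_fset_filter (T : choiceType) :
  ProperFilter (@eventually_fset T).
Proof.
apply: filter_from_proper; last by move=> E _; exists E => /=.
apply: filter_from_filter; first by exists fset0.
move=> E F _ _; exists (E `|` F)%fset => // D /=.
by rewrite fsubUset => /andP[].
Qed.

(** A cylinder is a finite intersection of preimages of points. *)
Lemma nbhs_cylinder (I : choiceType) (B : choiceType) (F : {fset I})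
    (x : {ptws I -> discrete_topology B}) :
  nbhs x [set y : {ptws I -> discrete_topology B} | forall i, i \in F -> y i = x i].
Proof.
have nb1 i : nbhs x [set y : {ptws I -> discrete_topology B} | y i = x i].
  exact: (@proj_continuous I (fun=> discrete_topology B) i x _
            (discrete_set1 _)).
elim/finSet_rect: F => F IH; case: (fset_0Vmem F) => [->|[i iF]].
  by apply: filterS filterT => y _ i; rewrite inE.
have := IH _ (fproperD1 iF); move: (nb1 i); apply: filterS2 => y yi yF j jF.
have [->//|ji] := eqVneq j i; apply: yF; by rewrite !inE ji.
Qed.

Lemma orbit_closure_window (G : groupType) (B : choiceType) (x p : G -> B) :
  orbit_closure x p ->
  forall F : {fset G}, exists g, forall h, h \in F -> shift g x h = p h.
Proof.
move=> cp F; have [_ [[g _ <-] gp]] := cp _ (nbhs_cylinder F p).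
by exists g.
Qed.

(** Translates that agree with [p] on larger and larger windows converge to [p]
pointwise. *)
Lemma window_orbit_closure (G : groupType) (B : choiceType) (x p : G -> B) :
  (forall F : {fset G}, exists g, forall h, h \in F -> shift g x h = p h) ->
  orbit_closure x p.
Proof.
move=> /choice[g gP]; have FF := eventually_fset_filter G.
pose u (F : {fset G}) : {ptws G -> discrete_topology B} := shift (g F) x.
have up : u @ (@eventually_fset G) --> (p : {ptws G -> discrete_topology B}).
  apply/cvg_sup => i; rewrite cvg_image; last first.
    by rewrite eqEsubset; split=> v // _; exists (cst v).
  move=> W Wp.
  have {}Wp : W (p i) := nbhs_singleton Wp.
  exists ((fun f : G -> discrete_topology B => f i) @^-1` W).
    exists [fset i] => // F /= iF; rewrite /u gP //.
    by apply: (fsubsetP iF); rewrite inE.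
  by rewrite eqEsubset; split => [j [? + <-//]|j Wj]; exists (fun _ => j).
move=> U /up [F _ FU]; exists (u F); split; first by exists (g F).
by apply: FU => /=.
Qed.

(** Tychonoff's theorem, the alphabet being finite. *)
Lemma configuration_compact (G : choiceType) (A : finType) :
  compact [set: {ptws G -> discrete_topology A}].
Proof.
have := @tychonoff G (fun=> discrete_topology A) (fun=> setT).
rewrite (_ : [set f | _] = setT); last by rewrite eqEsubset; split.
apply=> _; apply: finite_compact.
exact: (@finite_finset A setT).
Qed.

(** A finite set that works on a cylinder around each configuration can be chosen
uniformly: finitely many cylinders cover the space of configurations. *)
Lemma compact_uniform_fset (G : choiceType) (A : finType)
    (P : {fset G} -> (G -> A) -> Prop) :
  (forall x : G -> A, exists F E : {fset G}, forall x' E',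
     (forall g, g \in F -> x' g = x g) -> (E `<=` E')%fset -> P E' x') ->
  exists E, forall x, P E x.
Proof.
move=> Ploc; have FF := eventually_fset_filter G.
have /compact_near_coveringP cpt := @configuration_compact G A.
have [x _|E _ EP] := cpt {fset G} (@eventually_fset G) P FF; last first.
  by exists E => x; apply: (EP E) => //=.
have [F [E FE]] := Ploc x.
exists ([set y | forall g, g \in F -> y g = x g], [set E' | E `<=` E']%fset) => /=.
  by split; [exact: nbhs_cylinder | exists E].
by move=> [y E'] /= [yx EE']; apply: FE.
Qed.

(** * Finite subsets of a group and asymptotic configurations *)

Section FsetProducts.
Variable G : groupType.
Implicit Types X Y : {fset G}.

Definition fsmul X Y : {fset G} := [fset x * y | x in X, y in Y].
Definition fsinv X : {fset G} := [fset x^-1 | x in X].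

Lemma mem_fsmul X Y x y : x \in X -> y \in Y -> x * y \in fsmul X Y.
Proof. by move=> xX yY; apply/imfset2P; exists x => //; exists y. Qed.

Lemma fsmulP X Y z :
  reflect (exists x y, [/\ x \in X, y \in Y & z = x * y]) (z \in fsmul X Y).
Proof.
apply: (iffP (imfset2P _ _ _ _ _)) => [[x xX [y yY ->]]|[x [y [xX yY ->]]]].
  by exists x, y.
by exists x => //; exists y.
Qed.

Lemma mem_fsinv X x : (x \in fsinv X) = (x^-1 \in X).
Proof.
apply/imfsetP/idP => [[y yX ->]|xX]; first by rewrite invgK.
by exists x^-1; rewrite ?invgK.
Qed.

End FsetProducts.

Section Asymptotic.
Variables (G : groupType) (B : Type).
Implicit Types x y z : G -> B.

Lemma asymptotic_sym x y : asymptotic x y -> asymptotic y x.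
Proof. by case=> E xy; exists E => g /xy. Qed.

Lemma asymptotic_trans y x z :
  asymptotic x y -> asymptotic y z -> asymptotic x z.
Proof.
move=> [E xy] [F yz]; exists (E `|` F)%fset => g.
by rewrite inE negb_or => /andP[/xy-> /yz].
Qed.

End Asymptotic.

(** * Maps with finite memory *)

Section FiniteMemory.
Variables (G : groupType) (A : finType).
Implicit Types (f tau rho : (G -> A) -> G -> A) (N M D E F : {fset G}).
Implicit Types x y z : G -> A.

(** For a nonempty alphabet these are the maps [nuca t] with rules on [N]
([nuca_local_rule]); working with maps avoids manipulating rules. *)
Definition memory f N :=
  forall x y g, (forall n, n \in N -> x (g * n) = y (g * n)) -> f x g = f y g.

Definition equivariant f := forall h x, f (shift h x) = shift h (f x).

Definition pre_injective f := forall x y, asymptotic x y -> f x = f y -> x = y.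

Lemma nucaE M (s : G -> local_maps A M) x g :
  nuca s x g = s g [ffun m : M => x (g * val m)].
Proof. by rewrite /nuca /shift invgK. Qed.

Lemma nuca_memory M (s : G -> local_maps A M) : memory (nuca s) M.
Proof.
move=> x y g xy; rewrite !nucaE; congr (s g _).
by apply/ffunP => m; rewrite !ffunE xy //; exact: valP.
Qed.

Lemma nuca_shift M (s : G -> local_maps A M) h x :
  nuca (shift h s) x = shift h (nuca s (shift h^-1 x)).
Proof.
apply/funext => g; rewrite {2}/shift !nucaE /shift; congr (s _ _).
by apply/ffunP => m; rewrite !ffunE invgK -mulgA mulVKg.
Qed.

Lemma nuca_const_equivariant M (c : local_maps A M) :
  equivariant (nuca (fun=> c)).
Proof.
move=> h x; have := nuca_shift (fun=> c) h (shift h x).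
rewrite (_ : shift h^-1 (shift h x) = x) //.
by apply/funext => g; rewrite /shift mulgA mulgV mul1g.
Qed.

Lemma memory_comp f1 f2 N1 N2 :
  memory f1 N1 -> memory f2 N2 -> memory (f1 \o f2) (fsmul N1 N2).
Proof.
move=> mf1 mf2 x y g xy; apply: mf1 => n nN1; apply: mf2 => m mN2.
by rewrite -!mulgA; apply: xy; exact: mem_fsmul.
Qed.

Lemma memory_asymptotic f N x y :
  memory f N -> asymptotic x y -> asymptotic (f x) (f y).
Proof.
move=> mf [E xy]; exists (fsmul E (fsinv N)) => g gE; apply: mf => n nN.
apply: xy; apply: contra gE => gnE; apply/fsmulP; exists (g * n), n^-1.
by rewrite mem_fsinv invgK mulgK.
Qed.

(** The value [a] outside [g * N] is immaterial to a map with memory [N]. *)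
Definition extend (a : A) N g (u : {ffun N -> A}) : G -> A :=
  fun h => if insub (g^-1 * h) is Some n then u n else a.

Definition local_rule (a : A) N f : G -> local_maps A N :=
  fun g => [ffun u => f (extend a g u) g].

Lemma extend_mem a N g (u : {ffun N -> A}) n :
  extend a g u (g * val n) = u n.
Proof. by rewrite /extend mulKg valK. Qed.

Lemma nuca_local_rule a N f : memory f N -> nuca (local_rule a N f) = f.
Proof.
move=> mf; apply/funext => x; apply/funext => g.
rewrite nucaE ffunE; apply: mf => n nN.
by rewrite -[n]/(val [` nN]%fset) extend_mem ffunE.
Qed.

(** With [nuca_local_rule], this makes an equivariant map with finite memory a
cellular automaton. *)
Lemma local_rule_const a N f : equivariant f ->
  local_rule a N f = fun=> local_rule a N f 1.
Proof.
move=> ef; apply/funext => g; apply/ffunP => u; rewrite !ffunE.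
have -> : extend a g u = shift g (extend a 1 u).
  by apply/funext => h; rewrite /shift /extend invg1 mul1g.
by rewrite ef /shift mulVg.
Qed.

(** The set [E] is the same for all [x] and [a]; post-surjectivity alone lets it
depend on [x]. *)
Definition corrects f E := forall x a,
  exists z, [/\ forall g, g \notin E -> z g = x g, f z 1 = a
              & forall g : G, g != 1 -> f z g = f x g].

(** If a change of [x] inside [E] corrects [f x], then the same change corrects
[f x'] for every [x'] that agrees with [x] on a finite window around [E]; so
compactness provides a common [E]. *)
Lemma post_surjective_corrects f N :
  memory f N -> post_surjective f -> exists E, corrects f E.
Proof.
move=> mf post.
pose P E x := forall a, exists z,
  [/\ forall g, g \notin E -> z g = x g, f z 1 = a
    & forall g : G, g != 1 -> f z g = f x g].
suff [E EP] : exists E, forall x, P E x by exists E.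
apply: compact_uniform_fset => x.
pose y a (g : G) := if g == 1 then a else f x g.
have yP a : exists zE : (G -> A) * {fset G},
    (forall g, g \notin zE.2 -> zE.1 g = x g) /\ f zE.1 = y a.
  have [|z [E zx] fz] := post x (y a); last by exists (z, E).
  by exists [fset 1] => g; rewrite inE /y => /negPf->.
have {}/choice[w wP] := yP.
pose z a := (w a).1.
pose E : {fset G} := (\bigcup_(a <- enum A) (w a).2)%fset.
have zx a g : g \notin E -> z a g = x g.
  move=> gE; apply: (wP a).1; apply: contra gE => gE.
  by apply/bigfcupP; exists a; rewrite ?mem_enum.
have fz a : f (z a) = y a := (wP a).2.
(* [W] contains every cell seen from the cell [1] or from a cell that sees [E]. *)
pose W := (E `|` fsmul (1 |` fsmul E (fsinv N)) N)%fset.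
exists W, E => x' E' x'x EE' a.
pose z' g := if g \in E then z a g else x' g.
have z'E g : g \notin E -> z' g = x' g by rewrite /z' => /negPf->.
have z'W g : g \in W -> z' g = z a g.
  move=> gW; rewrite /z'; case: ifPn => // gE; rewrite x'x // zx //.
have far g : g \notin fsmul E (fsinv N) -> f z' g = f x' g.
  move=> gE; apply: mf => n nN; apply: z'E; apply: contra gE => gnE.
  by apply/fsmulP; exists (g * n), n^-1; rewrite mem_fsinv invgK mulgK.
have near g : g \in (1 |` fsmul E (fsinv N))%fset ->
    f z' g = f (z a) g /\ f x' g = f x g.
  move=> gE; split; apply: mf => n nN; [apply: z'W | apply: x'x];
    by rewrite in_fsetU orbC mem_fsmul.
have z1 : f z' 1 = a.
  by rewrite (near _ _).1 ?fz /y ?eqxx // !inE eqxx.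
exists z'; split=> // g => [gE'|g1].
- by apply: z'E; apply: contra gE'; apply/fsubsetP.
- have [gE|] := boolP (g \in fsmul E (fsinv N)); last exact: far.
  have gE1 : g \in (1 |` fsmul E (fsinv N))%fset by rewrite in_fsetU gE orbT.
  have [-> ->] := near g gE1.
  by rewrite fz /y (negPf g1).
Qed.

(** * A pre-injective automaton with uniform corrections is invertible *)

Section LocalInverse.
Variables (tau : (G -> A) -> G -> A) (M E : {fset G}).
Hypotheses (tauM : memory tau M) (tauG : equivariant tau).
Hypotheses (tauE : corrects tau E).

Lemma correct_site x g a : exists z,
  [/\ forall h, g^-1 * h \notin E -> z h = x h, tau z g = a
    & forall h, h != g -> tau z h = tau x h].
Proof.
have [z [zx z1 zn]] := tauE (shift g^-1 x) a.
exists (shift g z); split; first 1 last.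
- by rewrite tauG /shift mulVg.
- move=> h hg; rewrite tauG /shift zn ?tauG /shift ?invgK ?mulVKg //.
  by apply: contra hg => /eqP gh; rewrite -(mulVKg g h) gh mulg1.
- by move=> h hE; rewrite /shift zx // /shift invgK mulVKg.
Qed.

(** The corrections at the sites of [l] do not disturb each other, since each of
them alters the image at a single cell. *)
Lemma correct_sites (l : seq G) x y : (forall h, h \notin l -> y h = tau x h) ->
  exists2 z, tau z = y &
    forall h, (forall g, g \in l -> g^-1 * h \notin E) -> z h = x h.
Proof.
elim: l x => [|g l IH] x yx; first by exists x => //; apply/funext => h; rewrite yx.
have [z1 [z1x z1g z1n]] := correct_site x g (y g).
have [h hl|z zy zx] := IH z1.
  have [->|hg] := eqVneq h g; first by rewrite z1g.
  by rewrite z1n // yx // inE negb_or hg.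
exists z => // h hl; rewrite zx ?z1x //; first by apply: hl; rewrite inE eqxx.
by move=> k kl; apply: hl; rewrite inE kl orbT.
Qed.

Lemma realize_window (F : {fset G}) y :
  exists z, forall g, g \in F -> tau z g = y g.
Proof.
have [|z zy _] := @correct_sites F y (fun g => if g \in F then y g else tau y g).
  by move=> h /negPf->.
by exists z => g gF; rewrite zy gF.
Qed.

Hypothesis tau_inj : pre_injective tau.

(** Let [w] be [x'] on a finite [B] and [x] elsewhere. Then [tau w] differs from
[tau x] at finitely many cells, all outside [E^-1] because a cell of [E^-1]
only sees [B], where [tau x'] takes over. Correcting [tau x] into [tau w] thus
leaves [x 1] unchanged, while by pre-injectivity it turns [x] into [w]. *)
Lemma local_injectivity1 x x' :
  (forall g, g \in fsinv E -> tau x g = tau x' g) -> x 1 = x' 1.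
Proof.
move=> xx'; pose B := (1 |` fsmul (fsinv E) M)%fset.
pose w h := if h \in B then x' h else x h.
pose l := [seq h <- enum_fset (fsmul B (fsinv M)) | h \notin fsinv E].
have [h|z zw zx] := @correct_sites l x (tau w).
  rewrite mem_filter negb_and negbK => /orP[hE|hB].
    rewrite xx' //; apply: tauM => m mM.
    by rewrite /w in_fsetU mem_fsmul ?orbT.
  apply: tauM => m mM; rewrite /w ifN //; apply: contra hB => hmB.
  by apply/fsmulP; exists (h * m), m^-1; rewrite mem_fsinv invgK mulgK.
have wx : asymptotic w x by exists B => g /negPf gB; rewrite /w gB.
have {}zx1 : asymptotic z x.
  exists (fsmul [fset h in l] E) => h hl; apply: zx => g gl.
  apply: contra hl => ghE; apply/fsmulP; exists g, (g^-1 * h).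
  by rewrite mulVKg inE.
have {}zw : z = w.
  by apply: tau_inj zw; apply: asymptotic_trans zx1 (asymptotic_sym wx).
rewrite -zx ?zw /w ?inE ?eqxx // => g.
by rewrite mem_filter mem_fsinv mulg1 => /andP[].
Qed.

Lemma local_injectivity x x' g :
  (forall n, n \in fsinv E -> tau x (g * n) = tau x' (g * n)) -> x g = x' g.
Proof.
move=> xx'.
suff: shift g^-1 x 1 = shift g^-1 x' 1 by rewrite /shift invgK mulg1.
by apply: local_injectivity1 => h hE; rewrite !tauG /shift invgK xx'.
Qed.

(** The inverse at the cell [g] is computed from any [z] whose image agrees with
[y] on [g * E^-1]; by [local_injectivity] the choice does not matter. *)
Lemma local_inverse : exists rho,
  [/\ memory rho (fsinv E), equivariant rho, cancel tau rho & cancel rho tau].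
Proof.
have ex y g : exists z, forall n, n \in fsinv E -> tau z (g * n) = y (g * n).
  have [z zy] := realize_window (fsmul [fset g] (fsinv E)) y; exists z => n nE.
  by apply: zy; rewrite mem_fsmul ?inE.
have /choice[Z1 Z1P] (p : (G -> A) * G) := ex p.1 p.2.
pose Z y g := Z1 (y, g); have ZP y g : forall n, n \in fsinv E ->
  tau (Z y g) (g * n) = y (g * n) := Z1P (y, g).
pose rho y g := Z y g g.
have rhoE : memory rho (fsinv E).
  move=> x y g xy; apply: (@local_injectivity (Z x g) (Z y g)) => n nE.
  by rewrite !ZP // xy.
have tauK : cancel tau rho.
  move=> x; apply/funext => g.
  apply: (@local_injectivity (Z (tau x) g)) => n nE.
  by rewrite ZP.
have rhoK : cancel rho tau.
  move=> y; apply/funext => g.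
  have [z zy] := realize_window (g |` fsmul (fsmul [fset g] M) (fsinv E))%fset y.
  rewrite -zy ?inE ?eqxx //; apply: tauM => m mM.
  rewrite -[in RHS](tauK z); apply: rhoE => n nE.
  by rewrite zy // in_fsetU !mem_fsmul ?inE ?orbT.
exists rho; split=> // h y.
by rewrite -[in LHS](rhoK y) -tauG tauK.
Qed.

End LocalInverse.

(** * Post-surjective maps that are the identity outside a finite set *)

Section FinitePerturbation.
Variables (f : (G -> A) -> G -> A) (N D : {fset G}).
Hypotheses (fN : memory f N) (fpost : post_surjective f).
Hypothesis f_id : forall x g, g \notin D -> f x g = x g.

Let glue (u : {ffun D -> A}) y : G -> A :=
  fun g => if insub g is Some d then u d else y g.

Let glueD u y (d : D) : glue u y (val d) = u d.
Proof. by rewrite /glue valK. Qed.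

Let glueN u y g : g \notin D -> glue u y g = y g.
Proof. by move=> gD; rewrite /glue insubN. Qed.

Let glueK x y : (forall g, g \notin D -> x g = y g) ->
  glue [ffun d : D => x (val d)] y = x.
Proof.
move=> xy; apply/funext => g; have [gD|gD] := boolP (g \in D).
  by rewrite -[g]/(val [` gD]%fset) glueD ffunE.
by rewrite glueN // xy.
Qed.

(** Since [f y] and [y] are asymptotic, [y] itself is a legitimate target for
post-surjectivity at [y]. *)
Lemma perturbation_surjective y : exists z, f z = y.
Proof.
have [|z _ zy] := fpost (x := y) (y := y); last by exists z.
by exists D => g /f_id.
Qed.

(** With the values outside [D] fixed, [f] is a surjection of the finite set
[A^D] to itself, hence a bijection. *)
Lemma perturbation_injective : injective f.
Proof.
move=> x y fxy.
pose F (u : {ffun D -> A}) := [ffun d : D => f (glue u y) (val d)].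
have /choice[h hK] v : exists u, F u = v.
  have [z fz] := perturbation_surjective (glue v y).
  exists [ffun d : D => z (val d)]; apply/ffunP => d; rewrite ffunE glueK.
    by rewrite fz glueD.
  by move=> g gD; rewrite -(f_id z) // fz glueN.
have Finj : injective F.
  have [k kK hk] := injF_bij (can_inj hK).
  by move=> u v; rewrite -(hk u) -(hk v) !hK => ->.
have xy g : g \notin D -> x g = y g by move=> gD; rewrite -(f_id x gD) fxy f_id.
have -> : y = glue [ffun d : D => y (val d)] y by rewrite glueK.
rewrite -[LHS](glueK xy); congr (glue _ y); apply: Finj.
by apply/ffunP => d; rewrite !ffunE !glueK // fxy.
Qed.

(** The inverse at a cell of [D] depends on the cells seen from [D] only: if [y]
and [x] agree there, then the preimage of [x] on [D], completed by [y], is a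
preimage of [y]. *)
Lemma perturbation_inverse : exists rho N',
  [/\ memory rho N', cancel f rho, cancel rho f
    & forall y g, g \notin D -> rho y g = y g].
Proof.
have /choice[rho rhoK] := perturbation_surjective.
have rho_id y g : g \notin D -> rho y g = y g.
  by move=> gD; rewrite -[in RHS](rhoK y) f_id.
pose W := (D `|` fsmul D N)%fset.
have local x y : (forall g, g \in W -> x g = y g) ->
    forall g, g \in D -> rho x g = rho y g.
  move=> xy g gD; pose w h := if h \in D then rho x h else y h.
  have wW h : h \in W -> w h = rho x h.
    by move=> hW; rewrite /w; case: ifPn => // hD; rewrite rho_id // xy.
  suff fw : f w = y.
    have <- : w = rho y by apply: perturbation_injective; rewrite rhoK.
    by rewrite /w gD.
  apply/funext => h; have [hD|hD] := boolP (h \in D); last first.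
    by rewrite f_id // /w (negPf hD).
  rewrite -xy ?in_fsetU ?hD // -[in RHS](rhoK x); apply: fN => n nN.
  by apply: wW; rewrite in_fsetU mem_fsmul ?orbT.
exists rho, (1 |` fsmul (fsinv D) W)%fset; split=> //.
- move=> x y g xy; have [gD|gD] := boolP (g \in D).
    apply: local => // h hW; rewrite -(mulVKg g h); apply: xy.
    by rewrite in_fsetU mem_fsmul ?orbT // mem_fsinv invgK.
  by rewrite !rho_id // -(mulg1 g) xy // !inE eqxx.
- by move=> x; apply: perturbation_injective; rewrite rhoK.
Qed.

End FinitePerturbation.
End FiniteMemory.

(** * Sofic models *)

(** The permutations act on the right: [phi g v] is the point reached from [v] by
[g], so that following [g] and then [h] is following [g * h]. Around a good
point the model looks like [G] near [1], as far as [K] can tell. *)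
Definition good_vertex (G : groupType) n (phi : G -> 'S_n) (K : {fset G}) v :=
  [/\ forall g h, g \in K -> h \in K -> phi h (phi g v) = phi (g * h)%g v
    & forall g h, g \in K -> h \in K -> phi g v = phi h v -> g = h].

Section Discrepancy.
Import GRing.Theory Num.Theory Order.TTheory.
Local Open Scope ring_scope.

Lemma hamming_le_card (R : realType) n (s t : 'S_n) D : (0 < n)%N ->
  hamming R s t <= D.+1%:R^-1 ->
  (D.+1 * #|[set i | s i != t i]%SET| <= n)%N.
Proof.
move=> n0; rewrite /hamming ler_pdivrMr ?ltr0n // ler_pdivlMl ?ltr0n //.
by rewrite -natrM ler_nat.
Qed.

Lemma le_hamming_card (R : realType) n (s t : 'S_n) D : (0 < n)%N ->
  1 - D.+1%:R^-1 <= hamming R s t ->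
  (D.+1 * #|[set i | s i == t i]%SET| <= n)%N.
Proof.
move=> n0; rewrite /hamming ler_pdivlMr ?ltr0n // mulrBl mul1r.
set E := [set i | s i == t i]%SET.
have -> : [set i | s i != t i]%SET = ~: E by apply/setP => i; rewrite !inE.
have nE : n%:R = #|E|%:R + #|~: E|%:R :> R by rewrite -natrD cardsC card_ord.
rewrite lerBlDr {1}nE addrC lerD2l ler_pdivlMl ?ltr0n //.
by rewrite -natrM ler_nat.
Qed.

End Discrepancy.

(** A point is bad because of some pair in [K], and each pair spoils a proportion
of points that the sofic approximation makes as small as desired. *)
Lemma sofic_models (R : realType) (G : groupType) : sofic R G ->
  forall (K : {fset G}) C, exists n (phi : G -> 'S_n) (Q : {set 'I_n}),
  [/\ (0 < n)%N, forall v, v \in Q -> good_vertex phi K v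
    & (C * #|~: Q| <= n)%N].
Proof.
move=> sof K C; pose P := (K * K)%type; pose D := (2 * #|{: P}| * C)%N.
have D0 : (0 < D.+1%:R^-1 :> R)%R by rewrite Num.Theory.invr_gt0 Num.Theory.ltr0n.
have [n [phi [n0 morph sep]]] := sof K _ D0.
pose bad1 (p : P) :=
  [set v | phi (val p.1 * val p.2)%g v != (phi (val p.1) * phi (val p.2))%g v]%SET.
pose bad2 (p : P) := if p.1 == p.2 then finset.set0 else
  [set v | phi (val p.1) v == phi (val p.2) v]%SET.
pose bad p := bad1 p :|: bad2 p.
exists n, phi, (~: \bigcup_(p : P) bad p)%SET; split=> // [v|].
  rewrite finset.in_setC => vbad.
  have nbad p : v \notin bad p.
    by apply: contra vbad => vp; apply/bigcupP; exists p.
  split=> g h gK hK.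
    have := nbad ([` gK]%fset, [` hK]%fset).
    by rewrite !inE negb_or negbK permM => /andP[/eqP].
  move=> gh; apply/eqP; have := nbad ([` gK]%fset, [` hK]%fset).
  apply: contraNT => ngh; rewrite inE /bad2 /= ifN; last first.
    by apply: contra ngh => /eqP[->].
  by rewrite !inE gh eqxx orbT.
have bad_card p : (D.+1 * #|bad p| <= 2 * n)%N.
  apply: (@leq_trans (D.+1 * (#|bad1 p| + #|bad2 p|))).
    by rewrite leq_mul2l leq_card_setU orbT.
  rewrite mulnDr mul2n -addnn leq_add //.
    by apply: (hamming_le_card (R := R)) => //; apply: morph; apply: valP.
  rewrite /bad2; case: ifPn => [_|p12]; first by rewrite cards0 muln0.
  apply: (le_hamming_card (R := R)) => //; apply: sep; try exact: valP.
  by apply: contra p12 => /eqP/val_inj->.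
have : (D.+1 * #|(\bigcup_(p : P) bad p)%SET| <= \sum_(p : P) 2 * n)%N.
  apply: (big_ind2 (fun (X : {set 'I_n}) m => D.+1 * #|X| <= m)%N) => //.
    by rewrite cards0 muln0.
  move=> X a Y b Xa Yb; apply: leq_trans (leq_add Xa Yb).
  by rewrite -mulnDr leq_mul2l leq_card_setU orbT.
rewrite finset.setCK sum_nat_const /D.
set b := #|_|; set p := #|_| => le_b.
case: (posnP p) => p0; first by rewrite p0 in le_b *; nia.
rewrite -(@leq_pmul2l (2 * p)) ?muln_gt0 //; nia.
Qed.

(** * The automaton on a model *)

Section SoficModel.
Variables (G : groupType) (A : finType) (n : nat) (phi : G -> 'S_n).
Variables (f : (G -> A) -> G -> A) (M : {fset G}).
Hypotheses (fM : memory f M) (fG : equivariant f).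
Implicit Types (xi : {ffun 'I_n -> A}) (v w : 'I_n) (E K W : {fset G}).

(** What the group sees of the model when [1] is placed at [v]; with it [f] acts
on a model without reference to a local rule. *)
Definition pullback xi v : G -> A := fun g => xi (phi g v).

Definition model_map xi v : A := f (pullback xi v) 1.

Definition paste E v (z : G -> A) xi : {ffun 'I_n -> A} :=
  [ffun u => if [pick e : E | phi (val e) v == u] is Some e then z (val e)
             else xi u].

Lemma paste_out E v z xi u : (forall e, e \in E -> phi e v != u) ->
  paste E v z xi u = xi u.
Proof.
move=> uE; rewrite ffunE; case: pickP => // e /eqP eu.
by have := uE _ (valP e); rewrite eu eqxx.
Qed.

(** [K] contains whatever is seen when [f] is evaluated at the cells that see
[E]. *)
Definition covers K E :=
  [/\ 1 \in K, {subset E <= K}, {subset M <= K},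
      {subset fsmul E (fsinv M) <= K} & {subset fsmul (fsmul E (fsinv M)) M <= K}].

Lemma covers_exists E : exists K, covers K E.
Proof.
pose K1 := (1 |` (E `|` M))%fset; pose K2 := fsmul E (fsinv M).
exists (K1 `|` (K2 `|` fsmul K2 M))%fset.
split=> [|g gE|g gE|g gE|g gE]; rewrite !in_fsetU ?inE ?eqxx ?gE ?orbT //.
Qed.

Section GoodVertex.
Variables (K E : {fset G}) (v : 'I_n).
Hypotheses (KE : covers K E) (vK : good_vertex phi K v).

Lemma good_vertex1 : phi 1 v = v.
Proof.
by case: KE => K1 _ _ _ _; apply: (@perm_inj _ (phi 1)); rewrite vK.1 // mulg1.
Qed.

Lemma paste_in z xi g : g \in K ->
  paste E v z xi (phi g v) = if g \in E then z g else xi (phi g v).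
Proof.
case: KE => _ EK _ _ _ gK; case: ifPn => gE.
  rewrite ffunE; case: pickP => [e /eqP|/(_ [` gE]%fset)]; last by rewrite eqxx.
  by move/vK.2 => -> //; apply/EK/valP.
apply: paste_out => e eE; apply: contra gE => /eqP/vK.2 <- //; exact: EK.
Qed.

(** Around a good point the model map computes the values of [f], provided that
the pattern on the model is the one of a configuration [x]. *)
Lemma model_map_near xi (x : G -> A) g : g \in K ->
  (forall m, m \in M -> g * m \in K /\ xi (phi (g * m) v) = x (g * m)) ->
  model_map xi (phi g v) = f x g.
Proof.
case: KE => _ _ MK _ _ gK xix.
rewrite /model_map; have -> : f x g = f (shift g^-1 x) 1.
  by rewrite fG /shift invgK mulg1.
apply: fM => m mM; have [gmK xim] := xix m mM.
by rewrite mul1g /pullback /shift invgK -xim vK.1 // MK.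
Qed.

Lemma model_map_pullback xi g : g \in K -> (forall m, m \in M -> g * m \in K) ->
  model_map xi (phi g v) = f (pullback xi v) g.
Proof. by move=> gK gM; apply: model_map_near => // m /gM. Qed.

Lemma model_map_paste_near z xi g : g \in K ->
  (forall m, m \in M -> g * m \in K) ->
  model_map (paste E v z xi) (phi g v) =
  f (fun h => if h \in E then z h else pullback xi v h) g.
Proof.
move=> gK gM; apply: model_map_near => // m mM; split; first exact: gM.
by rewrite paste_in // gM.
Qed.

(** If [w] sees the cell [phi e v] through [m], then moving back along [m] in the
group shows that [w] is the point [phi (e * m^-1) v]. *)
Lemma model_map_paste_far z xi w :
  (forall g, g \in fsmul E (fsinv M) -> w != phi g v) ->
  model_map (paste E v z xi) w = model_map xi w.
Proof.
case: KE => _ EK MK EMK _ wE; apply: fM => m mM.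
rewrite mul1g; apply: paste_out => e eE.
have gE : e * m^-1 \in fsmul E (fsinv M) by rewrite mem_fsmul // mem_fsinv invgK.
apply: contra (wE _ gE) => /eqP emw; apply/eqP/(@perm_inj _ (phi m)).
by rewrite (vK.1 _ _ (EMK _ gE) (MK _ mM)) -mulgA mulVg mulg1.
Qed.

End GoodVertex.

(** The correction of [f] at [1] is transported to the model. *)
Lemma model_map_correct K E v xi a : covers K E -> good_vertex phi K v ->
  corrects f E -> exists xi', model_map xi' v = a /\
    forall w, w != v -> model_map xi' w = model_map xi w.
Proof.
move=> KE vK fE; have [z [zx z1 zn]] := fE (pullback xi v) a.
have zE : (fun h => if h \in E then z h else pullback xi v h) = z.
  by apply/funext => h; case: ifPn => // /zx.
have v1 := good_vertex1 KE vK; case: (KE) => K1 EK MK EMK EMMK.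
exists (paste E v z xi); split=> [|w wv].
  rewrite -{2}v1 (model_map_paste_near KE vK) ?zE // => m mM.
  by rewrite mul1g MK.
case: (pselect (exists2 g, g \in fsmul E (fsinv M) & w = phi g v)); last first.
  move=> nw; apply: (model_map_paste_far KE vK) => g gE.
  by apply/eqP => wg; apply: nw; exists g.
case=> g gE wg; have gM m : m \in M -> g * m \in K.
  by move=> mM; apply: EMMK; apply: mem_fsmul.
rewrite wg (model_map_paste_near KE vK) ?EMK // zE zn.
  by rewrite (model_map_pullback KE vK) ?EMK.
by apply: contra wv => /eqP g1; rewrite wg g1 v1.
Qed.

(** Correct the good points one after the other; no correction spoils another
point. *)
Lemma model_map_onto K E (Q : {set 'I_n}) (eta : 'I_n -> A) : covers K E ->
  (forall v, v \in Q -> good_vertex phi K v) -> corrects f E -> 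
  exists xi, forall v, v \in Q -> model_map xi v = eta v.
Proof.
move=> KE QK fE; pose xi0 : {ffun 'I_n -> A} := [ffun v => eta v].
suff [xi xiP] : exists xi, forall v, v \in enum Q -> model_map xi v = eta v.
  by exists xi => v vQ; apply: xiP; rewrite mem_enum.
have : {subset enum Q <= Q} by move=> v; rewrite mem_enum.
elim: (enum Q) => [|v l IH] lQ; first by exists xi0.
have [u ul|xi xil] := IH; first by apply: lQ; rewrite inE ul orbT.
have vK : good_vertex phi K v by apply/QK/lQ; rewrite inE eqxx.
have [xi' [xiv xiw]] := model_map_correct xi (eta v) KE vK fE.
exists xi' => w; have [->//|wv] := eqVneq w v.
by rewrite inE (negPf wv) /= => wl; rewrite xiw // xil.
Qed.

Section Collapse.
Variables (x x' : G -> A) (F W : {fset G}) (g0 : G).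
Hypotheses (xF : forall g, g \notin F -> x g = x' g) (fxx' : f x = f x').
Hypotheses (g0F : g0 \in F) (xg0 : x g0 != x' g0).
Hypotheses (FW : {subset F <= W}) (FMW : {subset fsmul (fsmul F (fsinv M)) M <= W}).
Variable K : {fset G}.
Hypotheses (KF : covers K F) (WK : {subset W <= K}).

Definition matches xi v := [ffun g : W => xi (phi (val g) v)] == [ffun g : W => x (val g)].

Lemma matchesP xi v :
  reflect (forall g, g \in W -> xi (phi g v) = x g) (matches xi v).
Proof.
apply: (iffP eqP) => [/ffunP xix g gW|xix].
  by have := xix [` gW]%fset; rewrite !ffunE.
by apply/ffunP => g; rewrite !ffunE; apply/xix/valP.
Qed.

(** Every point that sees the pasted cells has its whole neighbourhood inside the
copy of [W], where the pattern is that of [x] before and that of [x'] after;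
and [f x = f x']. *)
Lemma model_map_collapse xi v : good_vertex phi K v -> matches xi v ->
  model_map (paste F v x' xi) = model_map xi.
Proof.
move=> vK /matchesP xix; apply/funext => w.
case: (KF) => K1 FK MK FMK FMMK.
case: (pselect (exists2 g, g \in fsmul F (fsinv M) & w = phi g v)); last first.
  move=> nw; apply: (model_map_paste_far KF vK) => g gE.
  by apply/eqP => wg; apply: nw; exists g.
case=> g gF ->; have gM m : m \in M -> g * m \in fsmul (fsmul F (fsinv M)) M.
  by move=> mM; apply: mem_fsmul.
rewrite (model_map_near KF vK (x := x')) ?FMK //; last first.
  move=> m mM; rewrite (paste_in KF vK) ?FMMK ?gM //; split=> //.
  by case: ifPn => // /xF <-; apply/xix/FMW/gM.
rewrite -fxx' (model_map_near KF vK (x := x)) ?FMK // => m mM.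
by split; [apply/FMMK/gM | apply/xix/FMW/gM].
Qed.

(** Replace the occurrences of [x] one by one. As the copies of [W] are disjoint,
no replacement creates or destroys another occurrence. *)
Lemma model_map_avoid (U : {set 'I_n}) :
  (forall v, v \in U -> good_vertex phi K v) ->
  (forall u u' g g', u \in U -> u' \in U -> g \in W -> g' \in W ->
     phi g u = phi g' u' -> u = u') ->
  forall xi, exists xi', model_map xi' = model_map xi /\
    forall u, u \in U -> ~~ matches xi' u.
Proof.
move=> UK Usep xi.
suff [xi' [xi'xi xi'U]] : exists xi', model_map xi' = model_map xi /\
    forall u, u \in enum U -> ~~ matches xi' u.
  by exists xi'; split=> // u uU; apply: xi'U; rewrite mem_enum.
have : {subset enum U <= U} by move=> v; rewrite mem_enum.
elim: (enum U) => [|v l IH] lU; first by exists xi.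
have [u ul|xi1 [xi1xi xi1l]] := IH; first by apply: lU; rewrite inE ul orbT.
have vU : v \in U by apply: lU; rewrite inE eqxx.
have [vx|vx] := boolP (matches xi1 v); last first.
  by exists xi1; split=> // u; rewrite inE => /predU1P[->|/xi1l].
exists (paste F v x' xi1); rewrite (model_map_collapse (UK _ vU) vx); split=> // u.
rewrite inE; have [-> _|uv /= ul] := eqVneq u v.
  apply/matchesP => /(_ g0 (FW g0F)).
  rewrite (paste_in KF (UK _ vU)) ?g0F ?WK ?FW //.
  by move=> /esym/eqP; apply/negP.
have uU : u \in U by apply: lU; rewrite inE ul orbT.
apply: contra (xi1l u ul) => /matchesP ux; apply/matchesP => g gW.
rewrite -ux // paste_out // => e eF; apply: contra uv => /eqP ev.
by rewrite (Usep _ _ _ _ vU uU (FW eF) gW ev).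
Qed.

End Collapse.
End SoficModel.

Lemma covers_subset (G : groupType) (M K K' E : {fset G}) :
  {subset K <= K'} -> covers M K E -> covers M K' E.
Proof. by move=> KK' [? ? ? ? ?]; split=> [|g gE|g gE|g gE|g gE]; apply: KK'; auto. Qed.

(** Let [x] and [x'] be distinct, asymptotic and of equal image. Fix a model with
very few bad points and a maximal family [U] of good points around which the
copies of [W] are disjoint. Its size is at least a fixed proportion of the
number of points, as every good point is at bounded distance from [U]. The
inputs [B] that avoid [x] around [U] map onto the patterns on the good points,
which contradicts their number. *)
Theorem sofic_pre_injective (R : realType) (G : groupType) (A : finType)
    (f : (G -> A) -> G -> A) (M E : {fset G}) :
  sofic R G -> memory f M -> equivariant f -> corrects f E -> pre_injective f.
Proof.
move=> sof fM fG fE x x' [F xF] fxx'; apply/funext => g0; apply: contrapT => /eqP xg0.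
have g0F : g0 \in F by apply: contraNT xg0 => /xF->.
pose W := (F `|` fsmul (fsmul F (fsinv M)) M)%fset.
have FW : {subset F <= W} by move=> g gF; rewrite in_fsetU gF.
have FMW : {subset fsmul (fsmul F (fsinv M)) M <= W}.
  by move=> g gF; rewrite in_fsetU gF orbT.
pose S := fsmul W (fsinv W).
have SE g h : g \in W -> h \in W -> g * h^-1 \in S.
  by move=> gW hW; rewrite mem_fsmul // mem_fsinv invgK.
have [K1 K1E] := covers_exists M E; have [K2 K2F] := covers_exists M F.
pose K := (K1 `|` (K2 `|` (W `|` S)))%fset.
have KE : covers M K E.
  by apply: covers_subset K1E => g gK; rewrite !in_fsetU gK ?orbT.
have KF : covers M K F.
  by apply: covers_subset K2F => g gK; rewrite !in_fsetU gK ?orbT.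
have WK : {subset W <= K} by move=> g gK; rewrite 3!in_fsetU gK ?orbT.
have SK : {subset S <= K} by move=> g gK; rewrite 3!in_fsetU gK ?orbT.
have a2 : (1 < #|A|)%N.
  by rewrite cardT; case: (enum A) (mem_enum A (x g0)) (mem_enum A (x' g0)) xg0
    => [//|a [|//]]; rewrite !inE => /eqP-> /eqP->; rewrite eqxx.
have W0 : (0 < #|{: W}|)%N by apply/card_gt0P; exists [` FW _ g0F]%fset.
have S0 : (0 < #|{: S}|)%N.
  by apply/card_gt0P; exists [` SE _ _ (FW _ g0F) (FW _ g0F)]%fset.
set a := #|A| in a2; set alpha := (a ^ #|{: W}|)%N.
have alpha2 : (1 < alpha)%N by rewrite /alpha -(exp1n #|{: W}|) ltn_exp2r.
(* One of the [alpha] patterns on [W] is forbidden around each point of [U]. *)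
pose b := alpha.-1; have alphaE : alpha = b.+1 by rewrite prednK // ltnW.
have b0 : (0 < b)%N by rewrite /b; move: alpha2; case: (alpha) => [//|[]].
pose L := (b.+1 * a)%N.
(* With this bound on the number of bad points, [U] has more than [L] points
for each bad one. *)
have [n [phi [Q [n0 QK Qbig]]]] := sofic_models sof K ((#|{: S}| * L.+1).+1).
pose r (u v : 'I_n) := [exists p : W * W, phi (val p.1) u == phi (val p.2) v].
have [||U [UQ Usep Umax]] := @packing _ Q r.
- move=> u v; apply/existsP/existsP => -[[g h] /= /eqP gh];
    by exists (h, g); rewrite /= gh.
- by move=> v _; apply/existsP; exists ([` FW _ g0F]%fset, [` FW _ g0F]%fset) => /=.
have UK v : v \in U -> good_vertex phi K v by move=> /(fintype.subsetP UQ)/QK.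
have overlap u u' g g' : g \in W -> g' \in W -> phi g u = phi g' u' -> r u u'.
  move=> gW gW' gg; apply/existsP; exists ([` gW]%fset, [` gW']%fset) => /=.
  exact/eqP.
(* By maximality a good [v] has [phi h v = phi g u] with [u] in [U] and [g], [h]
in [W], so that [v = phi (g * h^-1) u]. *)
have le_QU : (#|Q| <= #|U| * #|{: S}|)%N.
  pose F1 (p : {u | u \in U} * S) := phi (val p.2) (val p.1).
  have -> : #|U| = #|{: {u | u \in U}}| by rewrite card_sig; apply: eq_card.
  rewrite -card_prod; apply: leq_trans (leq_imset_card F1 predT).
  apply: subset_leq_card; apply/fintype.subsetP => v vQ.
  have [u uU /existsP[[g h] /= /eqP gh]] := Umax v vQ.
  have gS := SE _ _ (valP g) (valP h).
  apply/imsetP; exists (exist _ u uU, [` gS]%fset) => //=.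
  have [morph _] := UK u uU.
  apply: (@perm_inj _ (phi (val h))).
  by rewrite /F1 /= (morph _ _ (SK _ gS) (WK _ (valP h))) -mulgA mulVg mulg1.
pose B := [set xi : {ffun 'I_n -> A} | [forall u in U, ~~ matches phi x W xi u]]%SET.
have le_QB : (a ^ #|Q| <= #|B|)%N.
  pose res (xi : {ffun 'I_n -> A}) :=
    [ffun v : {v | v \in Q} => model_map phi f xi (val v)].
  have -> : #|Q| = #|{: {v | v \in Q}}| by rewrite card_sig; apply: eq_card.
  rewrite -card_ffun; apply: leq_trans (leq_imset_card res B).
  apply: subset_leq_card; apply/fintype.subsetP => eta _.
  pose y v := if insub v is Some w then eta w else x g0.
  have [xi xiy] := model_map_onto fM fG y KE QK fE.
  have Usep' u u' g g' : u \in U -> u' \in U -> g \in W -> g' \in W ->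
      phi g u = phi g' u' -> u = u'.
    by move=> uU u'U gW gW' /(overlap _ _ _ _ gW gW'); apply: Usep.
  have [xi' [xi'xi xi'U]] :=
    model_map_avoid fM fG xF fxx' g0F xg0 FW FMW KF WK UK Usep' xi.
  apply/imsetP; exists xi'; first by rewrite inE; apply/forall_inP.
  by apply/ffunP => v; rewrite ffunE xi'xi xiy ?(valP v) // /y valK.
have := @card_avoiding _ W A U (fun u g => phi (val g) u) [ffun g : W => x (val g)] B.
rewrite -/a -/alpha card_ord => /(_ _ _) le_B.
apply: (@counting_contradiction a b #|~: Q| #|Q| n #|U| b0); last exact: ltnW.
- apply: leq_trans (leq_mul le_QB (leqnn _)) _; rewrite -alphaE /b; apply: le_B.
    move=> u u' g g' uU u'U gg.
    have uu : u = u' by apply: (Usep _ _ uU u'U); apply: overlap gg; apply: valP.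
    split=> //; apply: val_inj; have [_ inj] := UK u uU.
    by apply: inj; rewrite ?WK ?(valP g) ?(valP g') // gg uu.
  by move=> xi u; rewrite inE => /forall_inP/(_ u)/[apply].
- by rewrite cardsC card_ord.
apply: packing_density S0 n0 _ Qbig le_QU.
by rewrite cardsC card_ord.
Qed.

Lemma nuca_shift_cancel (G : groupType) (A : finType) (M N : {fset G})
    (s : G -> local_maps A M) (t : G -> local_maps A N) h :
  cancel (nuca t) (nuca s) -> cancel (nuca (shift h t)) (nuca (shift h s)).
Proof.
have shK k (B : Type) (x : G -> B) : shift k (shift k^-1 x) = x.
  by apply/funext => g; rewrite /shift invgK mulVKg.
move=> tsK x; rewrite !nuca_shift.
have -> y : shift h^-1 (shift h y) = y :> (G -> A).
  by have := shK h^-1 A y; rewrite invgK.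
by rewrite tsK shK.
Qed.

Lemma post_surjective_comp_inverse (G : groupType) (A : finType)
    (f tau rho : (G -> A) -> G -> A) (M : {fset G}) :
  memory tau M -> cancel tau rho -> cancel rho tau ->
  post_surjective f -> post_surjective (rho \o f).
Proof.
move=> tauM tauK rhoK fpost x y yx.
have [|z zx fz] := fpost x (tau y); last by exists z => //=; rewrite fz tauK.
by have := memory_asymptotic tauM yx; rewrite /= rhoK.
Qed.

Lemma orbit_closure_shift (G : groupType) (B : choiceType) (x : G -> B) g :
  orbit_closure x (shift g x).
Proof. by apply: subset_closure; exists g. Qed.

(** * Inverses along the orbit closure *)

Definition infinite_group (G : groupType) := forall X : {fset G}, exists g, g \notin X.

(** In an infinite group the finite exceptional set can be moved away from any
window. *)
Lemma infinite_orbit_closure (G : groupType) (B : choiceType) (x : G -> B) b :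
  infinite_group G -> asymptotic x (fun=> b) -> orbit_closure x (fun=> b).
Proof.
move=> Ginf [E xb]; apply: window_orbit_closure => F.
have [g gFE] := Ginf (fsmul F (fsinv E)); exists g => h hF.
rewrite /shift xb //; apply: contra gFE => ghE.
by apply/fsmulP; exists h, (g^-1 * h)^-1; rewrite mem_fsinv invgK invMg invgK mulVKg.
Qed.

(** If [p h0 != b], then the translates of [x] that agree with [p] at [h0] are
finitely many; were none of them [p], then some finite window would tell them
all from [p]. *)
Lemma orbit_closure_asymptotic (G : groupType) (B : choiceType) (x p : G -> B) b :
  asymptotic x (fun=> b) -> orbit_closure x p ->
  (exists g, p = shift g x) \/ p = (fun=> b).
Proof.
move=> [E xb] /orbit_closure_window px.
case: (pselect (exists h, p h != b)) => [[h0 ph0]|pb]; last first.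
  right; apply/funext => h; apply: contrapT => /eqP phb; apply: pb.
  by exists h.
left; apply: contrapT => np.
have diff g : exists h, shift g x h != p h.
  apply: contrapT => gp; apply: np; exists g; apply/funext => h.
  by apply/esym/eqP; apply: contrapT => /negP hp; apply: gp; exists h.
have /choice[d dP] := diff.
pose F := (h0 |` [fset d g | g in fsmul [fset h0] (fsinv E)])%fset.
have [g gF] := px F.
have : g \in fsmul [fset h0] (fsinv E).
  have xh0 : shift g x h0 = p h0 by apply: gF; rewrite in_fsetU fset11.
  apply: contraNT ph0 => gE; rewrite -xh0 /shift xb //.
  apply: contra gE => gE; apply/fsmulP; exists h0, (g^-1 * h0)^-1.
  by rewrite inE mem_fsinv invgK invMg invgK mulVKg.
move=> gE; have /eqP[] := dP g; apply: gF.
by rewrite in_fsetU; apply/orP; right; apply/imfsetP; exists g.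
Qed.

Lemma memory_subset (G : groupType) (A : finType) (f : (G -> A) -> G -> A)
    (N N' : {fset G}) : {subset N <= N'} -> memory f N -> memory f N'.
Proof. by move=> NN' fN x y g xy; apply: fN => n /NN'; apply: xy. Qed.

Lemma sofic_inverse (R : realType) (G : groupType) (A : finType)
    (tau : (G -> A) -> G -> A) (M : {fset G}) :
  sofic R G -> memory tau M -> equivariant tau -> post_surjective tau ->
  exists rho N, [/\ memory rho N, equivariant rho, cancel tau rho & cancel rho tau].
Proof.
move=> sof tauM tauG tau_post.
have [E tauE] := post_surjective_corrects tauM tau_post.
have tau_inj := sofic_pre_injective sof tauM tauG tauE.
have [rho] := local_inverse tauM tauG tauE tau_inj.
by exists rho, (fsinv E).
Qed.

(** The map [rho \o f] is a finite perturbation of the identity. *)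
Lemma asymptotic_inverse (G : groupType) (A : finType)
    (f tau rho : (G -> A) -> G -> A) (M N E : {fset G}) :
  memory f M -> memory tau M -> memory rho N ->
  cancel tau rho -> cancel rho tau -> post_surjective f ->
  (forall x g, g \notin E -> f x g = tau x g) ->
  exists sigma N' (D : {fset G}), [/\ memory sigma N', cancel f sigma, cancel sigma f
    & forall y g, g \notin D -> sigma y g = rho y g].
Proof.
move=> fM tauM rhoN tauK rhoK f_post ftau.
pose D := fsmul E (fsinv N).
have rf_id x g : g \notin D -> (rho \o f) x g = x g.
  move=> gD; rewrite -[in RHS](tauK x) /=; apply: rhoN => n nN.
  apply: ftau; apply: contra gD => gnE; apply/fsmulP; exists (g * n), n^-1.
  by rewrite mem_fsinv invgK mulgK.
have rf_post := post_surjective_comp_inverse tauM tauK rhoK f_post.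
have [pi [N' [piN' rfK piK pi_id]]] :=
  perturbation_inverse (memory_comp rhoN fM) rf_post rf_id.
exists (pi \o rho), (fsmul N' N), D; split.
- exact: memory_comp.
- by move=> x; apply: rfK.
- by move=> y; rewrite /= -[LHS]rhoK -[rho (f _)]/((rho \o f) _) piK rhoK.
- by move=> y g gD; rewrite /= pi_id.
Qed.

Lemma empty_alphabet_stably_invertible (G : groupType) (A : finType)
    (M : {fset G}) (s : G -> local_maps A M) :
  (A -> False) -> stably_invertible s.
Proof.
move=> A0; exists M, s => p sp; exists p => //.
by split; apply/funext => x; case: (A0 (x 1)).
Qed.

Theorem theoremC (R : realType) (G : groupType) (A : finType) (M : {fset G})
    (s : G -> local_maps A M) :
  finitely_generated G -> sofic R G ->
  asymptotically_constant s -> stably_post_surjective s ->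
  stably_invertible s.
Proof.
move=> _ sof [c sc] s_post.
case: (pselect (exists a : A, True)) => [[a _]|A0]; last first.
  by apply: empty_alphabet_stably_invertible => a; apply: A0; exists a.
have s_post1 : post_surjective (nuca s).
  have s1 : shift 1 s = s by apply/funext => g; rewrite /shift invg1 mul1g.
  by apply: s_post; rewrite -{2}s1; apply: orbit_closure_shift.
have sM := nuca_memory s.
have shift_case N (t : G -> local_maps A N) p :
    cancel (nuca s) (nuca t) -> cancel (nuca t) (nuca s) ->
    (exists g, p = shift g s) -> exists2 q, orbit_closure t q &
    nuca p \o nuca q = id /\ nuca q \o nuca p = id.
  move=> sK tK [g ->]; exists (shift g t); first exact: orbit_closure_shift.
  by split; apply/funext => x /=; apply: nuca_shift_cancel.
case: (pselect (infinite_group G)) => [Ginf|Gfin]; last first.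
  have [X XG] : exists X : {fset G}, forall g, g \in X.
    apply: contrapT => nX; apply: Gfin => X; apply: contrapT => nXg; apply: nX.
    by exists X => g; apply: contrapT => /negP gX; apply: nXg; exists g.
  have [|sigma [N [sigmaN sK sigmaK _]]] := @perturbation_inverse _ _ _ _ X sM s_post1.
    by move=> x g; rewrite XG.
  exists N, (local_rule a N sigma) => p /orbit_closure_window/(_ X)[g gp].
  apply: shift_case; rewrite ?nuca_local_rule //.
  by exists g; apply/funext => h; rewrite gp.
have c_post : post_surjective (nuca (fun=> c : local_maps A M)).
  exact/s_post/infinite_orbit_closure.
have [rho [N1 [rhoN1 rhoG cK rhoK]]] :=
  sofic_inverse sof (nuca_memory _) (nuca_const_equivariant c) c_post.
have [E sE] := sc.
have [|sigma [N2 [D [sigmaN2 sK sigmaK sigma_rho]]]] :=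
    asymptotic_inverse sM (nuca_memory _) rhoN1 cK rhoK s_post1 (E := E).
  by move=> x g gE; rewrite !nucaE sE.
pose N := (N1 `|` N2)%fset.
have rhoN : memory rho N.
  by apply: memory_subset rhoN1 => n nN; rewrite in_fsetU nN.
have sigmaN : memory sigma N.
  by apply: memory_subset sigmaN2 => n nN; rewrite in_fsetU nN orbT.
exists N, (local_rule a N sigma) => p /(orbit_closure_asymptotic sc)[pg|->].
  by apply: shift_case; rewrite ?nuca_local_rule.
exists (local_rule a N rho).
  rewrite (local_rule_const _ _ rhoG); apply: infinite_orbit_closure => //.
  exists D => g gD; rewrite -[RHS]/((fun=> local_rule a N rho 1) g).
  rewrite -local_rule_const //.
  by apply/ffunP => u; rewrite !ffunE sigma_rho.
by rewrite nuca_local_rule //; split; apply/funext => x /=.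
Qed.
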